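(* Let $M$ be a full affine semigroup and let $a$ be an atom of $M$. The following are equivalent: - $a$ is a strong atom; - $a$ is a pure atom; - $a$ is an extremal ray; - $\mathbb N a=\{ma\mid m\in\mathbb N\}$ is a face of $M$.
   Context: $\mathbb N$ denotes the nonnegative integers, $\mathbb Q_+$ the nonnegative rationals. An affine semigroup is a finitely generated submonoid $M$ of $(\mathbb N^n,+)$ for some positive $n$. With $\operatorname{G}(M)=\{a-b\mid a,b\in M\}\subseteq\mathbb Z^n$, $M$ is full if $\operatorname{G}(M)\cap\mathbb N^n=M$. For $a,b\in M$, $a\le_M b$ means $b-a\in M$. An atom is a nonzero element that is not a sum of two nonzero elements of $M$. An element $x\in M\setminus\{0\}$ is pure if for any $y\in M\setminus\{0\}$ with $y\le_M kx$ for some positive integer $k$, there are positive integers $m,n$ with $mx=ny$; a pure atom is an atom that is pure. A strong atom is an element $x\in M\setminus\{0\}$ such that if $y\le_M kx$ for some $y\in M$ and $k\in\mathbb N$, then $y=lx$ for some $l\in\mathbb N$. A face of a monoid $M$ is a submonoid $N$ such that whenever $a+b\in N$ with $a,b\in M$, then $a,b\in N$. $\operatorname{L}_{\mathbb Q_+}(M)=\{\sum_i r_is_i\mid r_i\in\mathbb Q_+,s_i\in M\}$ (finite sums) is the cone spanned by $M$ in $\mathbb Q^n$, an additive monoid. An atom $a$ of $M$ is an extremal ray if $\mathbb Q_+a$ is a face of $\operatorname{L}_{\mathbb Q_+}(M)$. *)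

(* Defs.v *)
From mathcomp Require Import all_boot all_order all_algebra.
From mathcomp Require Import mathcomp_extra boolp classical_sets.

Set Implicit Arguments.
Unset Strict Implicit.
Unset Printing Implicit Defensive.

Import Order.TTheory GRing.Theory Num.Theory.
Local Open Scope classical_set_scope.
Local Open Scope ring_scope.

Definition submonoid (V : nmodType) (N : set V) : Prop :=
  N 0 /\ forall x y, N x -> N y -> N (x + y).

Definition face (V : nmodType) (M N : set V) : Prop :=
  [/\ submonoid N, N `<=` M &
      forall a b, M a -> M b -> N (a + b) -> N a /\ N b].

(* N^n is the additive monoid of row vectors over nat; n > 0 is not built in. *)
Definition affine_semigroup (n : nat) (M : set 'rV[nat]_n) : Prop :=
  exists s : seq 'rV[nat]_n, M = smallest (@submonoid _) [set` s].

(* The inclusion of N^n in R^n, used for R = int and R = rat. *)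
Definition emb (R : nzRingType) (n : nat) (x : 'rV[nat]_n) : 'rV[R]_n :=
  map_mx (fun m : nat => m%:R) x.

Arguments emb R {n} x.

Definition diff_group (n : nat) (M : set 'rV[nat]_n) : set 'rV[int]_n :=
  [set z | exists a b, [/\ M a, M b & z = emb int a - emb int b]].

Definition full (n : nat) (M : set 'rV[nat]_n) : Prop :=
  diff_group M `&` range (emb int) = emb int @` M.

Definition le_monoid (n : nat) (M : set 'rV[nat]_n) (a b : 'rV[nat]_n) : Prop :=
  (emb int @` M) (emb int b - emb int a).

Definition atom (n : nat) (M : set 'rV[nat]_n) (a : 'rV[nat]_n) : Prop :=
  [/\ M a, a <> 0 &
      ~ exists b c, [/\ M b, b <> 0, M c, c <> 0 & a = b + c]].

Definition pure (n : nat) (M : set 'rV[nat]_n) (x : 'rV[nat]_n) : Prop :=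
  [/\ M x, x <> 0 &
      forall y, M y -> y <> 0 ->
        (exists2 k : nat, (0 < k)%N & le_monoid M y (x *+ k)) ->
        exists p q : nat, [/\ (0 < p)%N, (0 < q)%N & x *+ p = y *+ q]].

Definition pure_atom (n : nat) (M : set 'rV[nat]_n) (x : 'rV[nat]_n) : Prop :=
  atom M x /\ pure M x.

Definition strong_atom (n : nat) (M : set 'rV[nat]_n) (x : 'rV[nat]_n) : Prop :=
  [/\ M x, x <> 0 &
      forall (y : 'rV[nat]_n) (k : nat), M y -> le_monoid M y (x *+ k) ->
        exists l : nat, y = x *+ l].

Definition cone (n : nat) (M : set 'rV[nat]_n) : set 'rV[rat]_n :=
  [set v | exists (k : nat) (r : 'I_k -> rat) (s : 'I_k -> 'rV[nat]_n),
     [/\ forall i, 0 <= r i, forall i, M (s i) &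
         v = \sum_(i < k) r i *: emb rat (s i)]].

Definition ray (n : nat) (a : 'rV[nat]_n) : set 'rV[rat]_n :=
  [set r *: emb rat a | r in [set r : rat | 0 <= r]].

Definition extremal_ray (n : nat) (M : set 'rV[nat]_n) (a : 'rV[nat]_n) : Prop :=
  atom M a /\ face (cone M) (ray a).

Definition multiples (n : nat) (a : 'rV[nat]_n) : set 'rV[nat]_n :=
  [set a *+ m | m in [set: nat]].

(* Main.v *)
Require Import Defs.
From mathcomp Require Import all_boot all_order all_algebra.
From mathcomp Require Import mathcomp_extra boolp classical_sets.
From mathcomp Require Import ring.

(** Fullness enters in the step from extremal rays to faces of [M], where a
    rational multiple of [a] has to be turned into an integral one.  If
    [x] in [M] satisfies [q x = p a] with [q > 0], divide: [p = l q + s] with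
    [s < q].  Then [z = x - l a] has nonnegative entries, since [q z = s a], and
    [z <= a] entrywise, since [s < q].  Both [z] and [a - z] are vectors over
    the naturals lying in the difference group, so fullness puts them in [M],
    and [a = z + (a - z)] forces one of them to vanish because [a] is an atom.
    As [a] is nonzero, [q z = s a] with [s < q] rules out [z = a], so [x = l a]
    ([commensurable_multiple]).

    The other idea is to clear denominators: every element of the cone has a
    positive integer multiple in [M] ([cone_clear_denominators]).  So a
    decomposition [u + v = r a] inside the cone becomes a decomposition
    [y + z = k a] inside [M], to which purity of [a] applies, and conversely the
    face property of the ray restricts to [M].

    The remaining implications unfold the definitions, once [y <=_M k a] is read
    as the existence of [z] in [M] with [k a = y + z]: a strong atom is pure
    because [y = l a] is a commensurability relation, and if the multiples of
    [a] form a face then both summands [y] and [z] of [k a] are multiples of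
    [a]. *)

Set Implicit Arguments.
Unset Strict Implicit.
Unset Printing Implicit Defensive.

Import Order.TTheory GRing.Theory Num.Theory.
Local Open Scope classical_set_scope.
Local Open Scope ring_scope.

(** * Vectors of natural numbers inside a numeric domain *)

Section Embedding.
Variables (R : numDomainType) (n : nat).
Implicit Types x y : 'rV[nat]_n.

Lemma embD x y : emb R (x + y) = emb R x + emb R y.
Proof. by apply/rowP => i; rewrite !mxE natrD. Qed.

Lemma emb0 : emb R (0 : 'rV[nat]_n) = 0.
Proof. by apply/rowP => i; rewrite !mxE. Qed.

Lemma embMn x k : emb R (x *+ k) = emb R x *+ k.
Proof. by elim: k => [|k IH]; rewrite ?mulr0n ?emb0 // !mulrS embD IH. Qed.

Lemma emb_inj : injective (@emb R n).
Proof.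
by move=> x y /rowP eq_xy; apply/rowP => i; have := eq_xy i;
   rewrite !mxE => /eqP; rewrite eqr_nat => /eqP.
Qed.

End Embedding.

Lemma mulrn_rowE n (x : 'rV[nat]_n) k i : (x *+ k) 0 i = (x 0%R i * k)%N.
Proof. by elim: k => [|k IH]; rewrite ?mulr0n ?mxE ?muln0 // mulrS mxE IH mulnS. Qed.

Lemma row_subnK n (x y : 'rV[nat]_n) :
  (forall i, (y 0%R i <= x 0%R i)%N) -> exists z, x = y + z.
Proof.
move=> le_yx; exists (\row_i (x 0%R i - y 0%R i)%N).
by apply/rowP => i; rewrite !mxE; apply/esym/subnKC.
Qed.

(** * Submonoids of the lattice orthant *)

Section Monoid.
Variables (n : nat) (M : set 'rV[nat]_n).
Implicit Types x y z a : 'rV[nat]_n.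

Lemma affine_submonoid : affine_semigroup M -> submonoid M.
Proof.
move=> [s ->]; split=> [N [[]] //|x y Mx My N sN].
by case: (sN) => -[_ addN] _; apply: addN; [apply: Mx | apply: My].
Qed.

Lemma submonoidMn : submonoid M -> forall x k, M x -> M (x *+ k).
Proof.
move=> [M0 addM] x k Mx; elim: k => [|k IH]; rewrite ?mulr0n // mulrS.
exact: addM.
Qed.

Lemma le_monoidP x y : le_monoid M x y <-> exists2 z, M z & y = x + z.
Proof.
split=> [[z Mz eqz]|[z Mz ->]]; exists z => //.
  by apply: (@emb_inj int); rewrite embD eqz addrC subrK.
by rewrite embD addrC addKr.
Qed.

(** [y] is the difference of [x + y] and [x], so it lies in the difference group,
    and its coordinates are natural numbers. *)
Lemma full_cancel : full M -> forall x y, M x -> M (x + y) -> M y.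
Proof.
move=> fullM x y Mx Mxy.
have : (diff_group M `&` range (emb int)) (emb int y).
  split; last by exists y.
  by exists (x + y), x; split=> //; rewrite embD addrC addKr.
by rewrite fullM => -[z Mz /emb_inj <-].
Qed.

(** Division of [p] by [q] leaves a remainder vector between [0] and [a];
    fullness puts it and its complement in [M], and the atom [a] cannot be split
    by them. *)
Lemma commensurable_multiple a x p q :
  submonoid M -> full M -> atom M a -> M x -> (0 < q)%N ->
  x *+ q = a *+ p -> multiples a x.
Proof.
move=> subM fullM [Ma a_neq0 a_irr] Mx q_gt0 /rowP eq_xa.
pose l := (p %/ q)%N; pose s := (p %% q)%N.
have s_lt : (s < q)%N by rewrite ltn_mod.
have eq_i i : (x 0%R i * q = a 0%R i * l * q + a 0%R i * s)%N.
  by have := eq_xa i; rewrite !mulrn_rowE -mulnA -mulnDr -divn_eq.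
have [z def_x] : exists z, x = a *+ l + z.
  apply: row_subnK => i.
  by rewrite mulrn_rowE -(leq_pmul2r q_gt0) eq_i leq_addr.
have eq_z i : (z 0%R i * q = a 0%R i * s)%N.
  have := eq_i i; rewrite def_x mxE mulrn_rowE mulnDl.
  exact: addnI.
have [w def_a] : exists w, a = z + w.
  apply: row_subnK => i.
  by rewrite -(leq_pmul2r q_gt0) eq_z leq_mul2l (ltnW s_lt) orbT.
have Mz : M z.
  by apply: (full_cancel fullM (submonoidMn subM l Ma)); rewrite -def_x.
have Mw : M w by apply: (full_cancel fullM Mz); rewrite -def_a.
have [z0|/eqP z_neq0] := eqVneq z 0.
  by exists l; rewrite // def_x z0 addr0.
have [w0|/eqP w_neq0] := eqVneq w 0; last by case: a_irr; exists z, w.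
(* If w = 0 then z = a, so eq_z reads q a = s a, impossible for s < q and a <> 0. *)
have eq_az : a = z by rewrite [LHS]def_a w0 addr0.
case: a_neq0; apply/rowP => i; rewrite mxE; apply/eqP.
have /eqP := eq_z i; rewrite -eq_az eqn_mul2l.
by rewrite (gtn_eqF s_lt) orbF.
Qed.

End Monoid.

(** * Clearing denominators *)

Lemma nonneg_rat_frac (r : rat) : 0 <= r ->
  exists p q : nat, (0 < q)%N /\ q%:R * r = p%:R.
Proof.
move=> r_ge0; exists `|numq r|%N, `|denq r|%N; split.
  by rewrite absz_gt0 denq_neq0.
rewrite !pmulrn !gez0_abs ?denq_ge0 ?numq_ge0 //.
by rewrite mulrC numqE.
Qed.

Section Cone.
Variables (n : nat) (M : set 'rV[nat]_n).
Implicit Types (x y a : 'rV[nat]_n) (u v : 'rV[rat]_n).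

Lemma cone_gen x : M x -> forall r, 0 <= r -> cone M (r *: emb rat x).
Proof.
by move=> Mx r r_ge0; exists 1%N, (fun=> r), (fun=> x); rewrite big_ord1.
Qed.

Lemma ray_multiples a k : ray a (emb rat (a *+ k)).
Proof. by exists k%:R; rewrite /= ?ler0n // scaler_nat embMn. Qed.

Lemma emb_ray_commensurable a x : ray a (emb rat x) ->
  exists p q : nat, (0 < q)%N /\ x *+ q = a *+ p.
Proof.
move=> [r /= /nonneg_rat_frac[p [q [q_gt0 eq_pq]]] eq_x]; exists p, q.
split=> //; apply: (@emb_inj rat).
by rewrite !embMn -eq_x -!scaler_nat scalerA eq_pq.
Qed.

Lemma commensurable_ray a y u p q : (0 < q)%N ->
  q%:R *: u = emb rat y *+ p -> ray a (emb rat y) -> ray a u.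
Proof.
move=> q_gt0 eq_u [r /= r_ge0 eq_y].
have q_neq0 : q%:R != 0 :> rat by rewrite pnatr_eq0 -lt0n.
exists (q%:R^-1 * p%:R * r); first by rewrite /= !mulr_ge0 ?invr_ge0 ?ler0n.
by rewrite -!scalerA eq_y scaler_nat -eq_u scalerA mulVf // scale1r.
Qed.

(** Vectors with this property are closed under addition, by multiplying the two
    denominators, and contain the nonnegative rational multiples of elements of
    [M], hence all the sums that make up the cone. *)
Lemma cone_clear_denominators u : submonoid M -> cone M u ->
  exists2 q : nat, (0 < q)%N & exists2 y, M y & q%:R *: u = emb rat y.
Proof.
move=> subM [k [r [s [r_ge0 Ms ->]]]]; have [M0 addM] := subM.
elim/big_ind: _ => [|v w [p p_gt0 [y My eq_v]] [q q_gt0 [z Mz eq_w]]|i _].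
- by exists 1%N => //; exists 0; rewrite // scaler0 emb0.
- exists (p * q)%N; first by rewrite muln_gt0 p_gt0.
  exists (y *+ q + z *+ p); first by apply: addM; apply: submonoidMn.
  rewrite embD !embMn -eq_v -eq_w -!scaler_nat !scalerA -!natrM scalerDr.
  by rewrite (mulnC q).
- have [p [q [q_gt0 eq_pq]]] := nonneg_rat_frac (r_ge0 i).
  exists q => //; exists (s i *+ p); first exact: submonoidMn.
  by rewrite scalerA eq_pq scaler_nat embMn.
Qed.

End Cone.

(** * The four implications *)

Section Implications.
Variables (n : nat) (M : set 'rV[nat]_n) (a : 'rV[nat]_n).

Lemma strong_atom_pure : strong_atom M a -> pure M a.
Proof.
move=> [Ma a_neq0 strong]; split=> // y My y_neq0 [k _ /(strong _ _ My)[l eq_y]].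
exists l, 1%N; split=> //.
by rewrite lt0n; apply/eqP => l0; apply: y_neq0; rewrite eq_y l0 mulr0n.
Qed.

(** After clearing denominators [u] becomes an element [y'] of [M] below a multiple
    of [a], and purity makes [y'] commensurable with [a].  Purity speaks of a
    single element below a multiple of [a], so one summand is treated here and
    the face property follows by symmetry. *)
Lemma pure_ray_summand u v : submonoid M -> pure M a ->
  cone M u -> cone M v -> ray a (u + v) -> ray a u.
Proof.
move=> subM [Ma a_neq0 pureM] Cu Cv [r /= r_ge0 eq_uv].
have [p p_gt0 [y My eq_u]] := cone_clear_denominators subM Cu.
have [q q_gt0 [z Mz eq_v]] := cone_clear_denominators subM Cv.
have [k [d [d_gt0 eq_r]]] := nonneg_rat_frac r_ge0.
(* Multiplying u + v = r a by d p q clears all three denominators. *)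
have eq_yz : a *+ (k * p * q) = y *+ (d * q) + z *+ (d * p).
  apply: (@emb_inj rat); rewrite embD !embMn -eq_u -eq_v -!scaler_nat !scalerA.
  rewrite !natrM -eq_r.
  have -> : d%:R * r * p%:R * q%:R = d%:R * p%:R * q%:R * r :> rat by ring.
  rewrite -[LHS]scalerA eq_uv scalerDr; congr (_ *: _ + _ *: _); ring.
set y' := y *+ (d * q) in eq_yz.
suff ray_y : ray a (emb rat y').
  apply: (@commensurable_ray _ a y' u 1 (p * (d * q)) _ _ ray_y).
    by rewrite !muln_gt0 p_gt0 d_gt0.
  by rewrite mulr1n embMn -eq_u mulnC natrM -scalerA scaler_nat.
have [y'0|/eqP y'_neq0] := eqVneq y' 0.
  by rewrite y'0 -(mulr0n a); apply: ray_multiples.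
(* Purity asks for a positive multiple of a; a zero multiple would force y' = 0. *)
have kpq_gt0 : (0 < k * p * q)%N.
  rewrite lt0n; apply/eqP => k0; apply: y'_neq0; apply/rowP => i; move/rowP/(_ i): eq_yz.
  by rewrite k0 mulr0n !mxE => /esym/eqP; rewrite addn_eq0 => /andP[/eqP].
have My' : M y' by apply: submonoidMn.
have [|b [c [b_gt0 c_gt0 eq_ay]]] := pureM y' My' y'_neq0.
  exists (k * p * q)%N => //; apply/le_monoidP.
  by exists (z *+ (d * p)) => //; apply: submonoidMn.
apply: (@commensurable_ray _ a (a *+ b) _ 1 c c_gt0); last exact: ray_multiples.
by rewrite mulr1n eq_ay (embMn _ y') scaler_nat.
Qed.

Lemma pure_extremal_ray : submonoid M -> pure_atom M a -> extremal_ray M a.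
Proof.
move=> subM [atom_a pure_a]; split=> //; split.
- split; first by exists 0; rewrite //= scale0r.
  move=> _ _ [r /= r_ge0 <-] [s /= s_ge0 <-].
  by exists (r + s); rewrite /= ?addr_ge0 // scalerDl.
- by move=> _ [r /= r_ge0 <-]; apply: cone_gen => //; case: pure_a.
- move=> u v Cu Cv ray_uv; split.
    exact: (pure_ray_summand subM pure_a Cu Cv ray_uv).
  by apply: (pure_ray_summand subM pure_a Cv Cu); rewrite addrC.
Qed.

Lemma extremal_ray_face_multiples : submonoid M -> full M ->
  extremal_ray M a -> face M (multiples a).
Proof.
move=> subM fullM [atom_a [_ _ face_ray]]; have [Ma _ _] := atom_a.
have emb_cone x : M x -> cone M (emb rat x).
  by move=> Mx; rewrite -[emb _ _]scale1r; apply: cone_gen.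
split.
- split; first by exists 0%N; rewrite ?mulr0n.
  by move=> _ _ [k _ <-] [l _ <-]; exists (k + l)%N; rewrite // mulrnDr.
- by move=> _ [k _ <-]; apply: submonoidMn.
- move=> x y Mx My [k _ eq_xy].
  have [] := face_ray _ _ (emb_cone x Mx) (emb_cone y My).
    by rewrite -embD -eq_xy; apply: ray_multiples.
  move=> /emb_ray_commensurable[p [q [q_gt0 eq_x]]].
  move=> /emb_ray_commensurable[p' [q' [q'_gt0 eq_y]]].
  split; first exact: (commensurable_multiple subM fullM atom_a Mx q_gt0 eq_x).
  exact: (commensurable_multiple subM fullM atom_a My q'_gt0 eq_y).
Qed.

Lemma face_multiples_strong : atom M a -> face M (multiples a) -> strong_atom M a.
Proof.
move=> [Ma a_neq0 _] [_ _ face_a]; split=> // y k My /le_monoidP[z Mz eq_yz].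
have [|[l _ <-] _] := face_a y z My Mz; first by exists k.
by exists l.
Qed.

End Implications.

Theorem corollary17 (n : nat) (n_gt0 : (0 < n)%N)
    (M : set 'rV[nat]_n) (M_affine : affine_semigroup M) (M_full : full M)
    (a : 'rV[nat]_n) (a_atom : atom M a) :
  [<-> strong_atom M a;
       pure_atom M a;
       extremal_ray M a;
       face M (multiples a)].
Proof.
have subM := affine_submonoid M_affine.
tfae.
- by move=> strong_a; split; last exact: strong_atom_pure.
- exact: pure_extremal_ray.
- exact: extremal_ray_face_multiples.
- exact: face_multiples_strong.
Qed.
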